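(* Let $I$ be a $t$-ideal of a PVMD $R$, let $\{Q_\alpha\}$ be the set of all maximal prime ideals of $Z(R,I)$, and let $\{M_\beta\}$ be the set of $t$-maximal ideals of $R$ that do not contain $I$. Then: (1) $(I:I)\supseteq\left(\bigcap_\alpha R_{Q_\alpha}\right)\cap\left(\bigcap_\beta R_{M_\beta}\right)$; (2) if $R$ is a $t$QR-domain, then equality holds.
   Context: Let $R$ be an integral domain with quotient field $K$. For nonzero fractional ideals $I,J$ of $R$, $(I:J)=\{x\in K : xJ\subseteq I\}$ and $I^{-1}=(R:I)$. The $v$-closure is $I_v=(I^{-1})^{-1}$ and the $t$-closure is $I_t=\bigcup J_v$, where $J$ ranges over the nonzero finitely generated subideals of $I$. A $t$-ideal of $R$ is a nonzero ideal $I\subseteq R$ with $I=I_t$. A $t$-maximal ideal is an ideal maximal among the proper $t$-ideals. A fractional ideal $I$ is $t$-invertible if $(II^{-1})_t=R$. $R$ is a PVMD (Prüfer $v$-multiplication domain) if every nonzero finitely generated ideal of $R$ is $t$-invertible. $Z(R,I)=\{x\in R : xa\in I \text{ for some } a\in R\setminus I\}$ is the set of elements of $R$ that are zero divisors on $R/I$; its maximal prime ideals are the prime ideals of $R$ that are maximal (under inclusion) among the prime ideals contained in $Z(R,I)$. An overring of $R$ is a ring $T$ with $R\subseteq T\subseteq K$; it is $t$-linked over $R$ if for each nonzero finitely generated ideal $A$ of $R$ with $A^{-1}=R$ one has $(T:AT)=T$. A $t$QR-domain is a PVMD $R$ such that each $t$-linked overring of $R$ is a quotient ring $R_S$ of $R$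 for some multiplicatively closed subset $S$ of $R$. Empty intersections of overrings are taken to be $K$. *)

(* Defs.v *)
From HB Require Import structures.
From mathcomp Require Import all_boot all_order all_algebra.
From mathcomp Require Import boolp classical_sets.

Set Implicit Arguments.
Unset Strict Implicit.
Unset Printing Implicit Defensive.

Import GRing.Theory.
Local Open Scope classical_set_scope.
Local Open Scope ring_scope.

(* An ideal of R is a subset of R, while fractional ideals, overrings and
   quotient rings of R are subsets of the quotient field {fraction R}.  An ideal
   A of R is regarded as a fractional ideal through its image [ext A]. *)

Section Ideals.
Variable R : idomainType.
Local Notation K := {fraction R}.
Local Notation "x %:F" := (@FracField.tofrac R x).

Definition ext (A : set R) : set K := [set x%:F | x in A].

(* [idealr_closed] would exclude the unit ideal, which is a t-ideal, hence the
   use of the submodules of R as an R-module. *)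
Definition ideal (A : set R) : Prop :=
  submod_closed (mem A : {pred R^o}).

Definition prime_ideal (Q : set R) : Prop :=
  idealr_closed (mem Q : {pred R}) /\ prime_idealr_closed (mem Q : {pred R}).

Definition nonzero_set (V : nmodType) (A : set V) : Prop :=
  exists2 x, A x & x <> 0.

(* The R-submodule of K generated by g_0, ..., g_(n-1); it has a common
   denominator, so it is a fractional ideal as soon as it is nonzero. *)
Definition gen (n : nat) (g : 'I_n -> K) : set K :=
  [set x | exists c : 'I_n -> R, x = \sum_(i < n) (c i)%:F * g i].

Definition fin_gen (J : set K) : Prop :=
  exists (n : nat) (g : 'I_n -> K), J = gen g.

Definition fg_ideal (A : set R) : Prop :=
  ideal A /\ fin_gen (ext A).

Definition colon (I J : set K) : set K :=
  [set x | forall y, J y -> I (x * y)].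

(* The product of two additive subgroups of K: finite sums of products. *)
Definition prodI (I J : set K) : set K :=
  [set x | exists (n : nat) (a b : 'I_n -> K),
     [/\ forall i, I (a i), forall i, J (b i) & x = \sum_(i < n) a i * b i]].

Definition invI (I : set K) : set K := colon (ext setT) I.

Definition v_closure (I : set K) : set K := invI (invI I).

Definition t_closure (I : set K) : set K :=
  \bigcup_(J in [set J | [/\ fin_gen J, nonzero_set J & J `<=` I]]) v_closure J.

Definition t_ideal (I : set R) : Prop :=
  [/\ ideal I, nonzero_set I & ext I = t_closure (ext I)].

Definition proper_t_ideal (I : set R) : Prop := t_ideal I /\ I <> setT.

Definition t_maximal (M : set R) : Prop :=
  proper_t_ideal M /\ (forall J, proper_t_ideal J -> M `<=` J -> J = M).

Definition t_invertible (I : set K) : Prop :=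
  t_closure (prodI I (invI I)) = ext setT.

Definition zerodiv (I : set R) : set R :=
  [set x | exists2 a, ~ I a & I (x * a)].

Definition maximal_prime_in (Z Q : set R) : Prop :=
  [/\ prime_ideal Q, Q `<=` Z &
      forall P, prime_ideal P -> P `<=` Z -> Q `<=` P -> P = Q].

Definition quot_ring (S : set R) : set K :=
  [set x | exists a s, S s /\ x = a%:F / s%:F].

Definition loc (Q : set R) : set K := quot_ring (~` Q).

(* 0 is excluded so that the quotient ring is an overring of R. *)
Definition mult_closed (S : set R) : Prop :=
  mulr_closed (mem S : {pred R}) /\ ~ S 0.

Definition overring (T : set K) : Prop :=
  subring_closed (mem T : {pred K}) /\ ext setT `<=` T.

Definition t_linked (T : set K) : Prop :=
  forall A : set R, fg_ideal A -> nonzero_set A ->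
    invI (ext A) = ext setT -> colon T (prodI (ext A) T) = T.

End Ideals.

Definition PVMD (R : idomainType) : Prop :=
  forall A : set R, fg_ideal A -> nonzero_set A -> t_invertible (ext A).

Definition tQR_domain (R : idomainType) : Prop :=
  PVMD R /\
  forall T : set {fraction R}, overring T -> t_linked T ->
    exists2 S : set R, mult_closed S & T = quot_ring S.

(* Main.v *)
Require Import Defs.
From mathcomp Require Import all_boot all_order all_algebra.
From mathcomp Require Import boolp classical_sets.
From mathcomp Require Import ring.

(** Write K for the quotient field and, for y in K, (I :_R y) for the ideal of
    the r in R with r y in I.  If I is a t-ideal, so is (I :_R y): multiplying a
    finitely generated T by a scalar y multiplies T_v by y ([t_ideal_scale],
    [residual_t_ideal]).  Together with Zorn's lemma this localizes membership:
    y lies in I as soon as (I :_R y) is contained in no t-maximal ideal.  The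
    same lemma shows that t-maximal ideals are prime.

    For the inclusion, let x be in the intersection of the localizations, let a
    be in I, and suppose that a t-maximal ideal M contains (I :_R x a).  If M does
    not contain I, a denominator of x outside M is in (I :_R x a), which is
    absurd.  If M contains I, the PVMD hypothesis enters through the fact that
    R_M is a valuation ring, stated in R as [PVMD_comparable].  Let J be the
    contraction of I R_M to R and let P be the set of zero divisors on R/J.
    Comparability makes P closed under addition, hence a prime ideal, and P is
    contained in Z(R, I); so P lies in some maximal prime Q of Z(R, I) and
    x = c / q with q not in Q, a fortiori not in P.  Comparing c a with q in R_M,
    either c a / q is in R_M, and q being regular modulo J puts it in I R_M, so
    that (I :_R x a) is not inside M; or q is in I R_M, whence q kills 1 modulo J
    and lies in P.  Both are absurd.

    For the equality, (I : I) is a t-linked overring: if A^-1 = R then A_v = R,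
    and x i A inside I forces x i in I.  In a tQR-domain it is therefore some
    R_S.  Each s in S is invertible in (I : I), so I = s I.  This makes s regular
    modulo I, hence outside every Q, and it puts s outside every ideal M that
    does not contain I, since I = s I is in M when s is.  So R_S is contained in
    all the localizations. *)

Set Implicit Arguments.
Unset Strict Implicit.
Unset Printing Implicit Defensive.

Import GRing.Theory.
Local Open Scope classical_set_scope.
Local Open Scope ring_scope.
Local Notation "x %:F" := (@FracField.tofrac _ x).

(** * Ideals and their images in the quotient field *)

(** [Zorn_bigcup] also asks for P of the union of the empty chain, and its maximal
    set need not contain A; applying it to the X such that P (A `|` X) settles
    both. *)
Lemma zorn_above (T : Type) (P : set (set T)) (A : set T) : P A ->
  (forall F, F !=set0 -> F `<=` P -> total_on F subset ->
     P (\bigcup_(X in F) X)) ->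
  exists M, [/\ P M, A `<=` M & forall B, P B -> M `<=` B -> B = M].
Proof.
move=> PA Pchain.
have [F FP Ftot|M [PM maxM]] := @Zorn_bigcup T (fun X => P (A `|` X)).
  have [->|/set0P F0] := eqVneq F set0; first by rewrite bigcup_set0 setU0.
  have -> : A `|` \bigcup_(X in F) X = \bigcup_(Y in [set A `|` X | X in F]) Y.
    rewrite eqEsubset; split=> x.
      case=> [Ax|[X FX Xx]]; last by exists (A `|` X); [exists X|right].
      by case: F0 => X FX; exists (A `|` X); [exists X|left].
    by move=> [_ [X FX <-] [Ax|Xx]]; [left|right; exists X].
  apply: Pchain.
  - by case: F0 => X FX; exists (A `|` X), X.
  - by move=> _ [X FX <-]; exact: FP.
  - move=> _ _ [X FX <-] [Y FY <-].
    by case: (Ftot X Y FX FY) => XY; [left|right]; exact: setUS.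
exists (A `|` M); split=> // B PB AMB; apply: contrapT => neB.
have MB : M `<=` B by move=> x Mx; apply: AMB; right.
have AB : A `<=` B by move=> x Ax; apply: AMB; left.
have := maxM B; rewrite (_ : A `|` B = B); last exact/setUidPr.
apply=> //.
split=> // BM; apply: neB; rewrite eqEsubset; split=> // x Bx.
by right; exact: BM.
Qed.

Section Ideals.
Variable R : idomainType.
Local Notation K := {fraction R}.
Implicit Types (I J M P Q A B : set R) (T : set K).
Implicit Types (a b c r s u v : R) (x y : K).

Lemma fraction_div x : exists a b, b <> 0 /\ x = a%:F / b%:F.
Proof.
elim/quotW: x => x; exists (frac x).1, (frac x).2.
have x0 := denom_ratioP x; split; first exact/eqP.
apply: (canRL (mulfK _)); first by rewrite tofrac_eq0.
rewrite !piE; apply/eqmodP.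
rewrite /= FracField.equivfE /FracField.mulf !numden_Ratio ?mulr1 ?oner_neq0 //.
by rewrite mulrC.
Qed.

Lemma ext_tofrac A r : ext A r%:F <-> A r.
Proof.
split=> [[s As /eqP]|Ar]; last by exists r.
by rewrite tofrac_eq => /eqP <-.
Qed.

Lemma idealP A :
  ideal A <-> A 0 /\ forall a u v, A u -> A v -> A (a * u + v).
Proof.
rewrite /ideal; split=> -[A0 Alin].
  split; first by move: A0; rewrite inE.
  move=> a u v Au Av; have := Alin a u v; rewrite !inE; exact.
split; first by rewrite inE.
by move=> a u v; rewrite !inE; exact: Alin.
Qed.

Lemma ideal0 A : ideal A -> A 0. Proof. by case/idealP. Qed.

Lemma idealD A u v : ideal A -> A u -> A v -> A (u + v).
Proof. by case/idealP=> _ Alin Au Av; rewrite -[u]mul1r; exact: Alin. Qed.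

Lemma idealM A a u : ideal A -> A u -> A (a * u).
Proof.
by case/idealP=> A0 Alin Au; rewrite -[a * u]addr0; exact: Alin.
Qed.

Lemma ideal1 A : ideal A -> A 1 -> A = setT.
Proof.
move=> idA A1; rewrite eqEsubset; split=> // r _.
by rewrite -[r]mulr1; exact: idealM.
Qed.

Lemma prime_idealP P : prime_ideal P <->
  [/\ ideal P, ~ P 1 & forall u v, P (u * v) -> P u \/ P v].
Proof.
split.
  move=> [[P0 P1 Plin] Pmul]; split.
  - apply/idealP; split; first by move: P0; rewrite inE.
    by move=> a u v Pu Pv; have := Plin a u v; rewrite !inE; exact.
  - by move: P1 => /negP; rewrite inE.
  - move=> u v Puv; have := Pmul u v; rewrite !inE => /(_ Puv) /orP[].
      by rewrite inE; left.
    by rewrite inE; right.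
move=> [/idealP [P0 Plin] P1 Pmul]; split.
  split; first by rewrite inE.
    by apply/negP; rewrite inE.
  by move=> a u v; rewrite !inE; exact: Plin.
move=> u v; rewrite inE => /Pmul [Pu|Pv]; apply/orP.
  by left; rewrite inE.
by right; rewrite inE.
Qed.

Lemma gen_mem n (g : 'I_n -> K) i : gen g (g i).
Proof.
exists (fun j => (j == i)%:R).
rewrite (bigD1 i) //= eqxx tofrac1 mul1r big1 ?addr0 // => j /negbTE ->.
by rewrite tofrac0 mul0r.
Qed.

Lemma ext_sum A n (f : 'I_n -> K) : ideal A -> (forall i, ext A (f i)) ->
  ext A (\sum_(i < n) f i).
Proof.
move=> idA fA; apply: (big_ind (ext A)) => // [|_ _ [a Aa <-] [b Ab <-]].
  by rewrite -tofrac0; apply/ext_tofrac; exact: ideal0.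
by rewrite -tofracD; apply/ext_tofrac; exact: idealD.
Qed.

Lemma extM A r x : ideal A -> ext A x -> ext A (r%:F * x).
Proof.
by move=> idA [a Aa <-]; rewrite -tofracM; apply/ext_tofrac; exact: idealM.
Qed.

Lemma gen_sub n (g : 'I_n -> K) A : ideal A ->
  (forall i, ext A (g i)) -> gen g `<=` ext A.
Proof. by move=> idA gA _ [c ->]; apply: ext_sum => // i; exact: extM. Qed.

(** * The v-closure and t-ideals *)

Lemma v_closure_scale (T T' : set K) y x : (forall z, T z -> T' (y * z)) ->
  v_closure T x -> v_closure T' (y * x).
Proof.
move=> TT' Tx w T'w; rewrite (_ : y * x * w = x * (w * y)); last by ring.
by apply: Tx => z Tz; rewrite -mulrA; apply: T'w; exact: TT'.
Qed.

Lemma v_closure_integral (T : set K) x : T `<=` ext setT ->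
  v_closure T x -> ext setT x.
Proof.
move=> TR Tx; rewrite -[x]mulr1; apply: Tx => z Tz; rewrite mul1r; exact: TR.
Qed.

Lemma sub_v_closure (T : set K) : T `<=` v_closure T.
Proof. by move=> x Tx w Tw; rewrite mulrC; exact: Tw. Qed.

(** For nonzero y one has (y T)_v = y T_v, so a t-ideal that contains y T
    contains y T_v. *)
Lemma t_ideal_scale I (T : set K) y : t_ideal I -> fin_gen T ->
  nonzero_set T -> (forall z, T z -> ext I (y * z)) ->
  forall x, v_closure T x -> ext I (y * x).
Proof.
move=> [idI _ It] [n [g ->]] [z gz z0] TI x Tx.
(* The t-closure ranges over nonzero modules, and y T is zero when y is. *)
have [->|/eqP y0] := eqVneq y 0.
  by rewrite mul0r -tofrac0; apply/ext_tofrac; exact: ideal0.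
have yg w : gen g w -> gen (fun i => y * g i) (y * w).
  move=> [c ->]; exists c; rewrite mulr_sumr; apply: eq_bigr => i _.
  by rewrite mulrCA.
rewrite It; exists (gen (fun i => y * g i)); last exact: v_closure_scale yg Tx.
split.
- by exists n, (fun i => y * g i).
- exists (y * z); first exact: yg.
  by apply/eqP; rewrite mulf_neq0//; apply/eqP.
- apply: gen_sub => // i; apply: TI; exact: gen_mem.
Qed.

(** An ideal always lies in its t-closure; a nonzero element i0 is added to the
    generators so that this also covers 0. *)
Lemma t_idealI I : ideal I -> nonzero_set I ->
  (forall T, fin_gen T -> nonzero_set T -> T `<=` ext I ->
     v_closure T `<=` ext I) -> t_ideal I.
Proof.
move=> idI [i0 Ii0 ni0] Iv; split=> //; first by exists i0.
rewrite eqEsubset; split=> [x Ix|x [T [Tfg T0 TI] Tx]]; last exact: Iv Tx.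
pose g (i : 'I_2) := if i == ord0 then x else i0%:F.
exists (gen g); last first.
  exact: (sub_v_closure (gen_mem g ord0)).
split; first by exists 2, g.
  exists i0%:F; first exact: (gen_mem g ord_max).
  by apply/eqP; rewrite tofrac_eq0; apply/eqP.
apply: gen_sub => // i; rewrite /g; case: ifP => // _; exact/ext_tofrac.
Qed.

(** The ideal (I :_R y) of R. *)
Definition residual I y : set R := [set r | ext I (r%:F * y)].

Lemma residual_ideal I y : ideal I -> ideal (residual I y).
Proof.
move=> idI; apply/idealP; split.
  rewrite /residual /= tofrac0 mul0r -tofrac0; apply/ext_tofrac.
  exact: ideal0.
move=> a u v [i Ii iE] [j Ij jE].
exists (a * i + j); first by have [_] := (idealP I).1 idI; exact.
by rewrite !tofracD !tofracM iE jE; ring.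
Qed.

Lemma residual_t_ideal I y : t_ideal I -> t_ideal (residual I y).
Proof.
move=> tI; have [idI [i0 Ii0 ni0] _] := tI.
apply: t_idealI; first exact: residual_ideal.
  have [a [b [b0 ->]]] := fraction_div y.
  have nb0 : b%:F != 0 by rewrite tofrac_eq0; apply/eqP.
  exists (b * i0); last by apply/eqP; rewrite mulf_neq0//; apply/eqP.
  exists (a * i0); first exact: idealM.
  by rewrite !tofracM [RHS]mulrC mulrA divfK.
move=> T Tfg T0 TB x Tx.
have [r _ rE] : ext setT x.
  by apply: v_closure_integral Tx => z /TB [r _ <-]; apply/ext_tofrac.
rewrite -rE; apply/ext_tofrac; rewrite /residual /= mulrC rE.
by apply: t_ideal_scale Tx => // z /TB [s Bs <-]; rewrite mulrC.
Qed.

(** * Maximal t-ideals and maximal primes of a set *)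

(** The finiteness that makes the union of a chain of t-ideals a t-ideal: a
    finitely generated module inside the union is inside a member. *)
Lemma chain_fin (X : Type) (F : set (set X)) n (h : 'I_n -> X) :
  F !=set0 -> total_on F subset ->
  (forall i, (\bigcup_(A in F) A) (h i)) ->
  exists2 A, F A & forall i, A (h i).
Proof.
move=> F0 Ftot; elim: n h => [|n IHn] h hF.
  by case: F0 => A FA; exists A => // -[].
have [A FA Ah] := IHn (h \o lift ord0) (fun i => hF _).
have [B FB Bh] := hF ord0.
have [AB|BA] := Ftot A B FA FB.
  by exists B => // i; case: (unliftP ord0 i) => [j|] -> //; exact/AB/Ah.
by exists A => // i; case: (unliftP ord0 i) => [j|] ->; [exact: Ah|exact: BA].
Qed.

Lemma bigcup_chain_ideal (F : set (set R)) : F !=set0 ->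
  total_on F subset -> (forall A, F A -> ideal A) ->
  ideal (\bigcup_(A in F) A).
Proof.
move=> [A0 FA0] Ftot Fid; apply/idealP; split.
  by exists A0 => //; apply: ideal0; exact: Fid.
move=> a u v [A FA Au] [B FB Bv].
have [AB|BA] := Ftot A B FA FB.
  by exists B => //; have [_] := (idealP B).1 (Fid B FB); apply=> //; exact: AB.
by exists A => //; have [_] := (idealP A).1 (Fid A FA); apply=> //; exact: BA.
Qed.

Lemma t_maximal_above I : t_ideal I -> ~ I 1 ->
  exists2 M, t_maximal M & I `<=` M.
Proof.
move=> tI I1.
have pI : proper_t_ideal I by split=> // IR; apply: I1; rewrite IR.
have [F F0 FP Ftot|M [tM IM maxM]] := @zorn_above R (@proper_t_ideal R) I pI.
  have Fid A : F A -> ideal A by case/FP => -[].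
  split; last first.
    move=> UR; have [A FA A1] : (\bigcup_(A in F) A) 1 by rewrite UR.
    by have [_] := FP A FA; apply; apply: ideal1 => //; exact: Fid.
  apply: t_idealI; first exact: bigcup_chain_ideal.
    case: F0 => A FA; have [[_ [r Ar r0] _] _] := FP A FA.
    by exists r => //; exists A.
  move=> _ [n [g ->]] g0 gU x gx.
  have /choice [h hE] i : exists r, (\bigcup_(A in F) A) r /\ r%:F = g i.
    by have [r Ur <-] := gU _ (gen_mem g i); exists r.
  have [A FA Ah] := chain_fin F0 Ftot (fun i => (hE i).1).
  have [r Ar <-] : ext A x.
    rewrite -[x]mul1r; apply: (t_ideal_scale (FP A FA).1 _ g0) gx.
      by exists n, g.
    move=> z; rewrite mul1r; apply: gen_sub; first exact: Fid.
    by move=> i; rewrite -(hE i).2; apply/ext_tofrac.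
  by apply/ext_tofrac; exists A.
by exists M.
Qed.

Lemma t_maximal1 M : t_maximal M -> ~ M 1.
Proof. by case=> [[[idM _ _] MR] _] M1; apply: MR; exact: ideal1. Qed.

Lemma t_maximal_ideal M : t_maximal M -> ideal M.
Proof. by case=> [[[]]]. Qed.

(** If u is not in M then (M :_R u) is a proper t-ideal containing M, so it is
    equal to M; but it contains every v with u v in M. *)
Lemma t_maximal_prime M : t_maximal M -> prime_ideal M.
Proof.
move=> mM; have idM := t_maximal_ideal mM.
apply/prime_idealP; split=> //; first exact: t_maximal1.
move=> u v Muv; have [Mu|nMu] := pselect (M u); [by left|right].
have [[tM MR] maxM] := mM.
rewrite -(maxM (residual M u%:F)).
- by rewrite /residual /= -tofracM mulrC; apply/ext_tofrac.
- split; first exact: residual_t_ideal.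
  move=> RE; apply: nMu; have : residual M u%:F 1 by rewrite RE.
  by rewrite /residual /= tofrac1 mul1r => /ext_tofrac.
- move=> m Mm; rewrite /residual /= -tofracM mulrC; apply/ext_tofrac.
  exact: idealM.
Qed.

Lemma maximal_prime_above (Z P : set R) : prime_ideal P -> P `<=` Z ->
  exists2 Q, maximal_prime_in Z Q & P `<=` Q.
Proof.
move=> pP PZ.
have [|F F0 FP Ftot|Q [[pQ QZ] PQ maxQ]] :=
    @zorn_above R (fun Q => prime_ideal Q /\ Q `<=` Z) P.
- by [].
- split; last by move=> x [A /FP [_ AZ]] /AZ.
  have Fpr A : F A -> [/\ ideal A, ~ A 1 & forall u v, A (u * v) -> A u \/ A v].
    by case/FP => /prime_idealP.
  apply/prime_idealP; split.
  + by apply: bigcup_chain_ideal => // A /Fpr [].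
  + by move=> [A /Fpr [_ A1 _]].
  + move=> u v [A FA]; have [_ _ Apr] := Fpr A FA.
    by case/Apr => ?; [left|right]; exists A.
- exists Q => //; split=> // P' pP' P'Z QP'; exact: maxQ.
Qed.

(** * Localization at a t-maximal ideal of a PVMD *)

(** The ring R_M is a valuation ring: u / v or v / u is of the form r / s with s
    outside M.  For A = (u, v) and p in A^-1 not sending both u and v into M, the
    elements p u and p v serve as numerator and denominator. *)
Lemma PVMD_comparable M u v : PVMD R -> t_maximal M ->
  exists s r, ~ M s /\ (s * u = r * v \/ s * v = r * u).
Proof.
move=> hR mM; have idM := t_maximal_ideal mM; have M1 := t_maximal1 mM.
have [->|/eqP u0] := eqVneq u 0.
  by exists 1, 0; split=> //; left; rewrite mulr0 mul0r.
pose g (i : 'I_2) := if i == ord0 then u%:F else v%:F.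
pose A := [set r | gen g r%:F].
have AE : ext A = gen g.
  rewrite eqEsubset; split=> [_ [r Ar <-] //|x gx].
  have [r _ rE] : ext setT x.
    apply: gen_sub gx; first by apply/idealP.
    by move=> i; rewrite /g; case: ifP => _; apply/ext_tofrac.
  by exists r => //; rewrite /A /= rE.
have idA : ideal A.
  apply/idealP; split.
    by exists (fun=> 0); rewrite big1 // => i _; rewrite tofrac0 mul0r.
  move=> a p q [c cE] [d dE]; exists (fun i => a * c i + d i).
  rewrite tofracD tofracM cE dE mulr_sumr -big_split; apply: eq_bigr => i _ /=.
  by rewrite tofracD tofracM mulrDl mulrA.
have Au : A u by exact: (gen_mem g ord0).
have Av : A v by exact: (gen_mem g ord_max).
have tA : t_invertible (ext A).
  by apply: hR; [split=> //; exists 2, g|exists u].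
(* As (A A^-1)_t = R, the product A A^-1 is not contained in the t-ideal M; an
   element p of A^-1 witnessing this moves u or v outside M. *)
have [p Ap npM] : exists2 p,
    invI (ext A) p & ~ (ext M (p * u%:F) /\ ext M (p * v%:F)).
  apply: contrapT => noP.
  have MA : prodI (ext A) (invI (ext A)) `<=` ext M.
    move=> _ [n [a [b [aA bA ->]]]]; apply: ext_sum => // i.
    have [Mu Mv] : ext M (b i * u%:F) /\ ext M (b i * v%:F).
      by apply: contrapT => nM; apply: noP; exists (b i).
    have := aA i; rewrite AE => -[c ->]; rewrite mulr_suml.
    apply: ext_sum => // k; rewrite -mulrA; apply: extM => //.
    by rewrite mulrC /g; case: ifP.
  have : t_closure (prodI (ext A) (invI (ext A))) 1.
    by rewrite tA -tofrac1; apply/ext_tofrac.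
  move=> [T [Tfg T0 TA] T1]; apply: M1; apply/ext_tofrac; rewrite tofrac1.
  rewrite -[1]mul1r; apply: t_ideal_scale T1 => //; first by case: mM => -[].
  by move=> z /TA /MA; rewrite mul1r.
have [pu _ puE] : ext setT (p * u%:F) by apply: Ap; apply/ext_tofrac.
have [pv _ pvE] : ext setT (p * v%:F) by apply: Ap; apply/ext_tofrac.
have comm : pu * v = pv * u.
  by apply/eqP; rewrite -tofrac_eq !tofracM puE pvE; apply/eqP; ring.
have [Mpu|nMpu] := pselect (M pu).
  exists pv, pu; split; last by left.
  by move=> Mpv; apply: npM; rewrite -puE -pvE; split; apply/ext_tofrac.
by exists pu, pv; split=> //; right.
Qed.

(** The contraction to R of the extension of I to R_M. *)
Definition localized I M : set R := [set r | exists2 s, ~ M s & I (s * r)].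

Lemma zerodiv_localized I M : prime_ideal M ->
  zerodiv (localized I M) `<=` zerodiv I.
Proof.
move=> /prime_idealP [_ _ Mpr] u [b nJb [s nMs Isub]].
exists (s * b); last by rewrite mulrCA.
by move=> Isb; apply: nJb; exists s.
Qed.

(** Closure under addition is where the valuation property enters: if s u = r v
    with s outside M, any b with v b in J is also multiplied into J by u, so one
    b serves for both summands. *)
Lemma zerodiv_localized_prime I M : PVMD R -> t_maximal M -> ideal I ->
  I `<=` M -> prime_ideal (zerodiv (localized I M)).
Proof.
move=> hR mM idI IM; have /prime_idealP [idM M1 Mpr] := t_maximal_prime mM.
have J1 : ~ localized I M 1 by move=> [s nMs]; rewrite mulr1 => /IM.
have JM a b : localized I M b -> localized I M (a * b).
  by move=> [s nMs Isb]; exists s => //; rewrite mulrCA; exact: idealM.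
have Jdiv s b : ~ M s -> localized I M (s * b) -> localized I M b.
  move=> nMs [t nMt Itsb]; exists (t * s); last by rewrite -mulrA.
  by case/Mpr.
have zdM a u : zerodiv (localized I M) u -> zerodiv (localized I M) (a * u).
  by move=> [b nJb Jub]; exists b => //; rewrite -mulrA; exact: JM.
have zdD u v : (exists s r, ~ M s /\ s * u = r * v) ->
    zerodiv (localized I M) v -> zerodiv (localized I M) (u + v).
  move=> [s [r [nMs suE]]] [b nJb Jvb]; exists b => //.
  apply: (Jdiv s) => //; rewrite mulrA mulrDr suE.
  by rewrite -mulrDl -mulrA; apply: JM.
apply/prime_idealP; split.
- apply/idealP; split.
    by exists 1 => //; exists 1 => //; rewrite mul0r mulr0; exact: ideal0.
  move=> a u v zu zv; have {zu}zau := zdM a u zu.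
  have [s [r [nMs [E|E]]]] := PVMD_comparable (a * u) v hR mM.
    by apply: zdD => //; exists s, r.
  by rewrite addrC; apply: zdD => //; exists s, r.
- by move=> [b nJb]; rewrite mul1r.
- move=> u v [b nJb Juvb].
  have [Jvb|nJvb] := pselect (localized I M (v * b)); first by right; exists b.
  by left; exists (v * b) => //; rewrite mulrA.
Qed.

(** * The ring of multipliers of a t-ideal *)

Lemma colon_of_local I x : PVMD R -> t_ideal I ->
  (forall Q, maximal_prime_in (zerodiv I) Q -> loc Q x) ->
  (forall M, t_maximal M -> ~ (I `<=` M) -> loc M x) ->
  colon (ext I) (ext I) x.
Proof.
move=> hR tI xQ xM _ [a Ia <-]; have [idI _ _] := tI.
have tB := residual_t_ideal (x * a%:F) tI.
have [B1|/(t_maximal_above tB) [M mM BM]] := pselect (residual I (x * a%:F) 1).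
  by rewrite -[_ * _]mul1r -tofrac1.
have pM := t_maximal_prime mM; have /prime_idealP [idM M1 Mpr] := pM.
have tofrac_neq0 (P : set R) q : ideal P -> ~ P q -> q%:F != 0.
  move=> idP nPq; rewrite tofrac_eq0; apply/eqP => q0.
  by apply: nPq; rewrite q0; exact: ideal0.
have [IM|nIM] := pselect (I `<=` M); last first.
  have [c [s [nMs xE]]] := xM M mM nIM.
  have s0 : s%:F != 0 by apply: tofrac_neq0 nMs.
  case: nMs; apply: BM.
  exists (c * a); first exact: idealM.
  by rewrite xE tofracM mulrA (mulrC s%:F) divfK.
have pP := zerodiv_localized_prime hR mM idI IM.
have [Q mQ PQ] := maximal_prime_above pP (zerodiv_localized (I:=I) pM).
have [c [q [nQq xE]]] := xQ Q mQ.
have nPq : ~ zerodiv (localized I M) q by move/PQ.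
have q0 : q%:F != 0.
  have /prime_idealP [idP _ _] := pP; exact: tofrac_neq0 nPq.
have [s [r [nMs [E|E]]]] := PVMD_comparable (c * a) q hR mM; last first.
  (* Here s q is in I, so that q annihilates 1 modulo I R_M. *)
  case: nPq; exists 1; first by move=> [t nMt]; rewrite mulr1 => /IM.
  exists s => //; rewrite mulr1 E mulrA; exact: idealM.
(* Here x a = r / s; as q r = s c a is in I and q is regular modulo I R_M, the
   element r is in I R_M. *)
have [t nMt Itr] : localized I M r.
  apply: contrapT => nJr; apply: nPq; exists r => //; exists 1 => //.
  rewrite mul1r mulrC -E mulrA; exact: idealM.
have : ~ M (t * s) by case/Mpr.
case; apply: BM; exists (t * r) => //.
have EF : s%:F * (c%:F * a%:F) = r%:F * q%:F by rewrite -!tofracM E.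
rewrite xE !tofracM; apply: (mulIf q0).
by rewrite -[LHS]mulrA -EF -[RHS]mulrA (mulrAC c%:F) divfK // [LHS]mulrA.
Qed.

Lemma colon_overring I : ideal I -> overring (colon (ext I) (ext I)).
Proof.
move=> idI; split; first split.
- by rewrite inE => y; rewrite mul1r.
- move=> x y; rewrite !inE => Ix Iy z Iz; rewrite mulrBl.
  have [i Ii <-] := Ix z Iz; have [j Ij <-] := Iy z Iz.
  rewrite -tofracB; apply/ext_tofrac; rewrite addrC -mulN1r.
  by have [_] := (idealP I).1 idI; apply.
- move=> x y; rewrite !inE => Ix Iy z Iz; rewrite -mulrA; exact/Ix/Iy.
move=> _ [r _ <-] _ [i Ii <-]; rewrite -tofracM; apply/ext_tofrac.
exact: idealM.
Qed.

(** The condition A^-1 = R says A_v = R, so x i A inside I gives x i in I by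
    [t_ideal_scale] applied to 1 in A_v. *)
Lemma colon_t_linked I : t_ideal I -> t_linked (colon (ext I) (ext I)).
Proof.
move=> tI A [idA Afg] A0 Ainv; set T := colon (ext I) (ext I).
have [idI _ _] := tI.
have [[T1 _ TM] RT] : overring T by exact: colon_overring.
rewrite eqEsubset; split=> x Tx.
  move=> y Iy.
  have A1 : v_closure (ext A) 1.
    by rewrite /v_closure Ainv => z; rewrite mul1r.
  rewrite -[x * y]mulr1; apply: t_ideal_scale A1 => //.
    case: A0 => r Ar r0; exists r%:F; first exact/ext_tofrac.
    by apply/eqP; rewrite tofrac_eq0; apply/eqP.
  move=> z Az; rewrite mulrAC; apply: Tx => //.
  exists 1, (fun=> z), (fun=> 1); split=> //.
    by move=> _; move: T1; rewrite inE.
  by rewrite big_ord1 mulr1.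
move=> y [n [a [b [aA bT ->]]]] z Iz.
rewrite mulr_sumr mulr_suml; apply: ext_sum => // i; have [r _ <-] := aA i.
rewrite (_ : _ * z = x * (r%:F * (b i * z))); last by ring.
by apply: Tx; apply: extM => //; exact: bT.
Qed.

Lemma colon_inv_dvd I s a : s%:F != 0 ->
  colon (ext I) (ext I) (s%:F^-1) -> I a ->
  exists2 b, I b & a = s * b.
Proof.
move=> s0 sI Ia; have [b Ib bE] : ext I (s%:F^-1 * a%:F).
  by apply: sI; exact/ext_tofrac.
exists b => //; apply/eqP; rewrite -tofrac_eq tofracM bE mulVKf //.
Qed.

(** Every s in S is a unit of the multiplier ring, so I = s I.  Hence s b in I
    gives b in I, and s in M gives I inside M. *)
Lemma quot_ring_colon_sub I (S : set R) : mult_closed S ->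
  colon (ext I) (ext I) = quot_ring S ->
  (forall Q, Q `<=` zerodiv I -> quot_ring S `<=` loc Q) /\
  (forall M, ideal M -> ~ (I `<=` M) -> quot_ring S `<=` loc M).
Proof.
move=> [[S1 _] S0] TS.
have Sdvd s a : S s -> I a -> exists2 b, I b & a = s * b.
  move=> Ss; apply: colon_inv_dvd.
    by rewrite tofrac_eq0; apply/eqP => s0; apply: S0; rewrite -s0.
  by rewrite TS; exists 1, s; rewrite tofrac1 div1r.
have Sneq0 s : S s -> s != 0.
  by move=> Ss; apply/eqP => s0; apply: S0; rewrite -s0.
split=> [Q QZ|M idM nIM] x [a [s [Ss ->]]]; exists a, s; split=> //.
  move=> /QZ [b nIb] /(Sdvd s _ Ss) [c Ic /(mulfI (Sneq0 s Ss)) bc].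
  by apply: nIb; rewrite bc.
move=> Ms; apply: nIM => b /(Sdvd s _ Ss) [c Ic ->].
by rewrite mulrC; exact: idealM.
Qed.
End Ideals.

Theorem theorem2p13 (R : idomainType) (I : set R) (hR : PVMD R)
    (hI : t_ideal I) :
  (\bigcap_(Q in [set Q | maximal_prime_in (zerodiv I) Q]) loc Q) `&`
  (\bigcap_(M in [set M | t_maximal M /\ ~ (I `<=` M)]) loc M)
    `<=` colon (ext I) (ext I)
  /\
  (tQR_domain R ->
   colon (ext I) (ext I) =
   (\bigcap_(Q in [set Q | maximal_prime_in (zerodiv I) Q]) loc Q) `&`
   (\bigcap_(M in [set M | t_maximal M /\ ~ (I `<=` M)]) loc M)).
Proof.
have sub : (\bigcap_(Q in [set Q | maximal_prime_in (zerodiv I) Q]) loc Q) `&`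
  (\bigcap_(M in [set M | t_maximal M /\ ~ (I `<=` M)]) loc M)
    `<=` colon (ext I) (ext I).
  move=> x [xQ xM]; apply: colon_of_local => //.
  by move=> M mM nIM; apply: xM.
split=> // -[_ hQR]; rewrite eqEsubset; split=> //.
have [idI _ _] := hI.
have [S mS TS] := hQR _ (colon_overring idI) (colon_t_linked hI).
have [SQ SM] := quot_ring_colon_sub mS TS.
rewrite TS => x Sx; split=> [Q [_ QZ _]|M [mM nIM]]; first exact: SQ.
by apply: SM => //; exact: t_maximal_ideal.
Qed.
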